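(* For $1\le i\le N$ let $\sigma(A_i+\beta_{ii}H_iC_i)=\{\mu_i^1,\dots,\mu_i^{q_i}\}$ be the set of distinct eigenvalues of $A_i+\beta_{ii}H_iC_i$, let $\gamma_{ij}$ be the geometric multiplicity of $\mu_i^j$ as an eigenvalue of $A_i+\beta_{ii}H_iC_i$, and let $\zeta_{ij}^k\in\mathbb{C}^{1\times n_i}$, $1\le k\le\gamma_{ij}$, be (linearly independent) left eigenvectors of $A_i+\beta_{ii}H_iC_i$ corresponding to $\mu_i^j$. Suppose that for all $i,l\in\{1,\dots,N\}$ with $\beta_{il}\neq 0$: - if $i>l$, then $H_iC_l=0$; - if $i<l$, then $\zeta_{ij}^kH_iC_l=0$ for all $1\le j\le q_i$ and $1\le k\le\gamma_{ij}$. Then $\sigma(\mathcal{A})=\bigcup_{i=1}^N\sigma(A_i+\beta_{ii}H_iC_i)$. Moreover, setting $$\eta_{ij}^k=[\,0_{1\times n_1}\ \cdots\ 0_{1\times n_{i-1}}\ \ \zeta_{ij}^k\ \ 0_{1\times n_{i+1}}\ \cdots\ 0_{1\times n_N}\,]\in\mathbb{C}^{1\times\mathcal{N}},$$ for every $\mu\in\sigma(\mathcal{A})$ the left eigenvectors of $\mathcal{A}$ corresponding to $\mu$ are given precisely by the vectors $\eta_{ij}^k$ with $\mu_i^j=\mu$, $1\le k\le\gamma_{ij}$, in the sense that these vectors form a basis of the left eigenspace $\{v\in\mathbb{C}^{1\times\mathcal{N}}: v\mathcal{A}=\mu v\}$.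
   Context: A networked system with $N$ nodes is given by data $A_i\in\mathbb{R}^{n_i\times n_i}$, $B_i\in\mathbb{R}^{n_i\times p_i}$, $C_i\in\mathbb{R}^{m\times n_i}$, $H_i\in\mathbb{R}^{n_i\times m}$ (inner-coupling matrices), $\delta_i\in\{0,1\}$ for $1\le i\le N$, and real numbers $\beta_{ij}$, $1\le i,j\le N$, where $\beta_{ij}\ne0$ if and only if there is an edge from node $j$ to node $i$. The node dynamics are $\dot x_i=A_ix_i+\sum_{j=1}^N\beta_{ij}H_iC_jx_j+\delta_iB_iu_i$, $y_i=C_ix_i$. Put $\mathcal{N}=\sum_{i=1}^Nn_i$. The network state matrix $\mathcal{A}\in\mathbb{R}^{\mathcal{N}\times\mathcal{N}}$ is $\mathcal{A}=\mathrm{blockdiag}\{A_1,\dots,A_N\}+(\beta_{ij}H_iC_j)_{i,j=1}^N$, i.e. its $(i,j)$ block is $\beta_{ij}H_iC_j$ for $i\ne j$ and $A_i+\beta_{ii}H_iC_i$ for $i=j$. $\sigma(M)$ denotes the set of (complex) eigenvalues of $M$. A left eigenvector of a square matrix $M$ for the eigenvalue $\mu$ is a nonzero row vector $v$ with $vM=\mu v$. *)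

(* Defs.v *)
From HB Require Import structures.
From mathcomp Require Import all_boot all_order all_algebra.
From mathcomp Require Import classical_sets reals.
From mathcomp Require Import complex.

Set Implicit Arguments.
Unset Strict Implicit.
Unset Printing Implicit Defensive.

Import GRing.Theory.
Local Open Scope ring_scope.
Local Open Scope complex_scope.

Record networked_system (R : realType) := NetworkedSystem {
  nodes : nat;
  out_dim : nat;
  state_dim : 'I_nodes -> nat;
  input_dim : 'I_nodes -> nat;
  node_A : forall i, 'M[R]_(state_dim i);
  node_B : forall i, 'M[R]_(state_dim i, input_dim i);
  node_C : forall i, 'M[R]_(out_dim, state_dim i);
  node_H : forall i, 'M[R]_(state_dim i, out_dim);
  delta : 'I_nodes -> bool;
  (* [beta i j] weighs the edge from j to i; it is nonzero iff there is one. *)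
  beta : 'I_nodes -> 'I_nodes -> R
}.

Definition self_loop_matrix (R : realType) (S : networked_system R)
    (i : 'I_(nodes S)) : 'M[R]_(state_dim i) :=
  node_A i + beta i i *: (node_H i *m node_C i).

Definition network_matrix (R : realType) (S : networked_system R) :
    'M[R]_(\sum_(i < nodes S) state_dim i) :=
  \mxdiag_(i < nodes S) node_A i
  + \mxblock_(i < nodes S, j < nodes S) (beta i j *: (node_H i *m node_C j)).

Definition cmx (R : realType) (m n : nat) (M : 'M[R]_(m, n)) : 'M[R[i]]_(m, n) :=
  map_mx (real_complex R) M.

Definition spectrum (R : realType) (n : nat) (M : 'M[R]_n) : set R[i] :=
  [set z | eigenvalue (cmx M) z].

Definition left_eigenvector (R : realType) (n : nat) (M : 'M[R]_n) (z : R[i])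
    (v : 'rV[R[i]]_n) : Prop :=
  v != 0 /\ v *m cmx M = z *: v.

Definition left_eigenspace (R : realType) (n : nat) (M : 'M[R]_n) (z : R[i]) :
    {vspace 'rV[R[i]]_n} :=
  passmx.leigenspace (linfun (mulmxr (cmx M))) z.

Lemma mem_left_eigenspace (R : realType) (n : nat) (M : 'M[R]_n) (z : R[i])
    (v : 'rV[R[i]]_n) :
  (v \in left_eigenspace M z) = (v *m cmx M == z *: v).
Proof.
by rewrite memv_ker add_lfunE opp_lfunE scale_lfunE id_lfunE lfunE /= subr_eq0.
Qed.

Definition geometric_multiplicity (R : realType) (n : nat) (M : 'M[R]_n)
    (z : R[i]) : nat :=
  \dim (left_eigenspace M z).

(* The row vector [0 .. 0 v 0 .. 0] with v in block i. *)
Definition block_embed (R : realType) (S : networked_system R)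
    (i : 'I_(nodes S)) (v : 'rV[R[i]]_(state_dim i)) :
    'rV[R[i]]_(\sum_(l < nodes S) state_dim l) :=
  \mxrow_(l < nodes S)
    dfwith (fun l : 'I_(nodes S) => 0 : 'rV[R[i]]_(state_dim l)) v l.

(* Main.v *)
Require Import Defs.
From HB Require Import structures.
From mathcomp Require Import all_boot all_order all_algebra.
From mathcomp Require Import classical_sets reals.
From mathcomp Require Import complex.

Set Implicit Arguments.
Unset Strict Implicit.
Unset Printing Implicit Defensive.

Import GRing.Theory.
Local Open Scope ring_scope.
Local Open Scope classical_set_scope.

(** The state matrix is block upper triangular: its blocks strictly below the
    diagonal are [beta i l *: H_i C_l] with [l < i], and those vanish.  Left
    eigenvectors see even more structure.  If [v A = z v] and [v_i] denotes the
    [i]-th block of [v], the [l]-th block of the equation reads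
      [v_l M_l + \sum_(i < l) beta_il v_i H_i C_l = z v_l],
    where [M_l] is the self-loop matrix of node [l].  For the first node the sum
    is empty, so [v_1] lies in the [z]-eigenspace of [M_1]; it is therefore a
    combination of the given eigenvectors of node 1, all of which annihilate
    [H_1 C_l] for every neighbour [l > 1].  The first node thus contributes
    nothing to the later equations, and induction on the node index shows that
    the equations decouple completely ([block_triangular_eigenP],
    [network_eigenP]): [v] is in the eigenspace of the network iff each [v_i]
    is in the eigenspace of [M_i], for the same [z].

    So the left eigenspace of the network at [z] is the direct sum of the
    embedded eigenspaces of the nodes.  Comparing when these are nonzero gives
    the equality of spectra, and the union of the embedded local bases is a
    basis: it spans because [v] is the sum of its embedded blocks
    ([sum_block_embed]), and it is free because taking the [i]-th block of a
    vanishing combination leaves a vanishing combination of the eigenvectors of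
    node [i] for the unique index [j] with [mu i j = z]. *)

Section ImageFamilies.
Variables (K : fieldType) (vT : vectType K) (T : finType).

(** Freeness tested with coefficients indexed by the family itself rather than
    by positions in its enumeration, so that sums over a dependent index type
    can be split component by component. *)
Lemma free_imageP (A : {pred T}) (f : T -> vT) :
  reflect (forall c : T -> K,
             \sum_(t in A) c t *: f t = 0 -> {in A, forall t, c t = 0})
          (free [seq f t | t in A]).
Proof.
apply: (iffP (@freeP _ _ _ (image_tuple f A))) => [f_free c c0 t At|f_free k k0 i].
  rewrite -(enum_rankK_in At At).
  apply: (f_free (fun i => c (enum_val i))).
  rewrite -[RHS]c0 [RHS]big_enum_val.
  by apply: eq_bigr => i _; rewrite nth_image.
have [x Ax] : exists x, x \in A by exists (enum_val i); apply: enum_valP.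
rewrite -(enum_valK_in Ax i).
apply: (f_free (fun t => k (enum_rank_in Ax t))); last exact: enum_valP.
rewrite -[RHS]k0 big_enum_val.
by apply: eq_bigr => j _; rewrite enum_valK_in nth_image.
Qed.

End ImageFamilies.

Section BlockRows.
Variables (F : fieldType) (N : nat) (p : 'I_N -> nat).

Lemma submxrowZ (a : F) (v : 'rV[F]_(\sum_l p l)) (l : 'I_N) :
  submxrow (a *: v) l = a *: submxrow v l.
Proof. by apply/matrixP=> x y; rewrite !mxE. Qed.

Lemma submxrow_mul_mxblock (B : forall i l, 'M[F]_(p i, p l))
    (v : 'rV[F]_(\sum_l p l)) (l : 'I_N) :
  submxrow (v *m \mxblock_(i, l) B i l) l = \sum_i submxrow v i *m B i l.
Proof. by rewrite -{1}[v]submxrowK mul_mxrow_mxblock mxrowK. Qed.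

(** Triangularity alone only makes the spectrum the union of the diagonal
    spectra.  The hypothesis [upperB] is what decouples the eigenvectors: once
    the blocks before [l] are known to be eigenvectors of their diagonal blocks,
    they vanish from the [l]-th equation, which drives a strong induction. *)
Lemma block_triangular_eigenP (B : forall i l, 'M[F]_(p i, p l)) (z : F)
    (lowerB : forall i l : 'I_N, (l < i)%N -> B i l = 0)
    (upperB : forall i l : 'I_N, (i < l)%N ->
       forall u : 'rV_(p i), u *m B i i = z *: u -> u *m B i l = 0)
    (v : 'rV[F]_(\sum_l p l)) :
  v *m \mxblock_(i, l) B i l = z *: v <->
  forall i, submxrow v i *m B i i = z *: submxrow v i.
Proof.
have diagonal_term (l : 'I_N) :
    (forall i : 'I_N, (i < l)%N ->
       submxrow v i *m B i i = z *: submxrow v i) ->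
    \sum_i submxrow v i *m B i l = submxrow v l *m B l l.
  move=> before; rewrite (bigD1 l) //= big1 ?addr0 // => i il.
  case: (ltngtP i l) => [lt_il|lt_li|eq_il].
  - exact: upperB (before i lt_il).
  - by rewrite lowerB // mulmx0.
  - by rewrite (val_inj eq_il) eqxx in il.
split=> [vB i|vB]; last first.
  apply/mxrowP => l.
  by rewrite submxrow_mul_mxblock submxrowZ diagonal_term.
have [n] := ubnP i; elim: n i => // n IHn i; rewrite ltnS => le_in.
have /mxrowP/(_ i) := vB; rewrite submxrow_mul_mxblock submxrowZ => <-.
by rewrite diagonal_term // => l lt_li; apply: IHn (leq_trans lt_li le_in).
Qed.

End BlockRows.

Section Network.
Variables (R : realType) (S : networked_system R).
Implicit Types (i l : 'I_(nodes S)) (z : R[i]).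

Lemma submxblock_network_diag i :
  submxblock (network_matrix S) i i = self_loop_matrix i.
Proof. by rewrite submxblockD submxblock_diag mxblockK. Qed.

Lemma submxblock_network_offdiag i l : i != l ->
  submxblock (network_matrix S) i l = beta i l *: (node_H i *m node_C l).
Proof.
by move=> /negPf il; rewrite submxblockD /mxdiag !mxblockK il add0r.
Qed.

Lemma submxblock_network_cmx i l :
  submxblock (cmx (network_matrix S)) i l =
  cmx (submxblock (network_matrix S) i l).
Proof. by apply/matrixP=> a b; rewrite !mxE. Qed.

Lemma spectrumP n (M : 'M[R]_n) z :
  spectrum M z <-> exists v, left_eigenvector M z v.
Proof.
split=> [/eigenvalueP[v vM v0]|[v [v0 vM]]]; first by exists v.
by apply/eigenvalueP; exists v.
Qed.

Lemma submxrow_embed_id i (v : 'rV[R[i]]_(state_dim i)) :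
  submxrow (block_embed v) i = v.
Proof. by rewrite mxrowK dfwith_in. Qed.

Lemma submxrow_embed_out i l (v : 'rV[R[i]]_(state_dim i)) : i != l ->
  submxrow (block_embed v) l = 0.
Proof. by move=> il; rewrite mxrowK dfwith_out. Qed.

Lemma block_embed_is_linear i : linear (@block_embed R S i).
Proof.
move=> a u v; apply/mxrowP => l.
rewrite submxrowD submxrowZ.
have [<-|il] := eqVneq i l; first by rewrite !submxrow_embed_id.
by rewrite !submxrow_embed_out // scaler0 addr0.
Qed.

HB.instance Definition _ i := GRing.isLinear.Build R[i]
  'rV[R[i]]_(state_dim i) 'rV[R[i]]_(\sum_(l < nodes S) state_dim l) _
  (@block_embed R S i) (@block_embed_is_linear i).

Lemma sum_block_embed (v : 'rV[R[i]]_(\sum_(l < nodes S) state_dim l)) :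
  v = \sum_i block_embed (submxrow v i).
Proof.
apply/mxrowP => l; rewrite submxrow_sum (bigD1 l) //= submxrow_embed_id.
by rewrite big1 ?addr0 // => i il; rewrite submxrow_embed_out.
Qed.

(** The hypothesis [upper] bears on whole eigenspaces rather than on a chosen
    family of eigenvectors, which is the form that the induction on blocks
    consumes.  An absent edge gives a zero block through its weight, hence the
    case analyses on [beta i l]. *)
Lemma network_eigenP z
    (lower : forall i l, beta i l != 0 -> (l < i)%N ->
       node_H i *m node_C l = 0)
    (upper : forall i l, beta i l != 0 -> (i < l)%N ->
       forall u : 'rV_(state_dim i), u *m cmx (self_loop_matrix i) = z *: u ->
         u *m cmx (node_H i *m node_C l) = 0)
    (v : 'rV[R[i]]_(\sum_(l < nodes S) state_dim l)) :
  v *m cmx (network_matrix S) = z *: v <->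
  forall i, submxrow v i *m cmx (self_loop_matrix i) = z *: submxrow v i.
Proof.
pose B i l := submxblock (cmx (network_matrix S)) i l.
have B_diag i : B i i = cmx (self_loop_matrix i).
  by rewrite /B submxblock_network_cmx submxblock_network_diag.
have B_off i l : i != l ->
    B i l = real_complex R (beta i l) *: cmx (node_H i *m node_C l).
  move=> il; rewrite /B submxblock_network_cmx submxblock_network_offdiag //.
  by rewrite /cmx map_mxZ.
have -> : cmx (network_matrix S) = \mxblock_(i, l) B i l by rewrite submxblockK.
have eqv := @block_triangular_eigenP _ _ _ B z _ _ v.
rewrite eqv => [|i l lt_li|i l lt_il u].
- by split=> vM i; move: (vM i); rewrite B_diag.
- rewrite B_off ?neq_ltn ?lt_li ?orbT //.
  have [->|bil] := eqVneq (beta i l) 0; first by rewrite rmorph0 scale0r.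
  by rewrite lower // /cmx map_mx0 scaler0.
- rewrite B_diag B_off ?neq_ltn ?lt_il // => uM.
  have [->|bil] := eqVneq (beta i l) 0; first by rewrite rmorph0 scale0r mulmx0.
  by rewrite -scalemxAr upper // scaler0.
Qed.

End Network.

Theorem theorem4p2 (R : realType) (S : networked_system R)
    (q : 'I_(nodes S) -> nat)
    (mu : forall i : 'I_(nodes S), 'I_(q i) -> R[i])
    (mu_inj : forall i : 'I_(nodes S), injective (mu i))
    (mu_spectrum : forall i : 'I_(nodes S),
       spectrum (self_loop_matrix i) = range (mu i))
    (gamma : forall i : 'I_(nodes S), 'I_(q i) -> nat)
    (gammaE : forall (i : 'I_(nodes S)) (j : 'I_(q i)),
       gamma i j = geometric_multiplicity (self_loop_matrix i) (mu i j))
    (zeta : forall (i : 'I_(nodes S)) (j : 'I_(q i)),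
       'I_(gamma i j) -> 'rV[R[i]]_(state_dim i))
    (zeta_eigen : forall (i : 'I_(nodes S)) (j : 'I_(q i)) (k : 'I_(gamma i j)),
       left_eigenvector (self_loop_matrix i) (mu i j) (zeta i j k))
    (zeta_free : forall (i : 'I_(nodes S)) (j : 'I_(q i)),
       free [seq zeta i j k | k : 'I_(gamma i j)])
    (lower : forall i l : 'I_(nodes S), beta i l != 0 -> (l < i)%N ->
       node_H i *m node_C l = 0)
    (upper : forall i l : 'I_(nodes S), beta i l != 0 -> (i < l)%N ->
       forall (j : 'I_(q i)) (k : 'I_(gamma i j)),
         zeta i j k *m cmx (node_H i *m node_C l) = 0) :
  spectrum (network_matrix S)
    = \bigcup_(i in [set: 'I_(nodes S)]) spectrum (self_loop_matrix i)
  /\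
  forall z : R[i], spectrum (network_matrix S) z ->
    basis_of (left_eigenspace (network_matrix S) z)
      [seq block_embed (zeta (tag t) (tag (tagged t)) (tagged (tagged t)))
        | t : {i : 'I_(nodes S) & {j : 'I_(q i) & 'I_(gamma i j)}}
          in [pred t | mu (tag t) (tag (tagged t)) == z]].
Proof.
(* [gamma i j] free vectors in an eigenspace of dimension [gamma i j]. *)
have zeta_basis i j :
    basis_of (left_eigenspace (self_loop_matrix i) (mu i j))
             [seq zeta i j k | k : 'I_(gamma i j)].
  have size_zeta : size [seq zeta i j k | k : 'I_(gamma i j)] = gamma i j.
    by rewrite size_image card_ord.
  rewrite basisEfree zeta_free size_zeta.
  rewrite -[\dim _]/(geometric_multiplicity _ _) -gammaE leqnn andbT.
  apply/span_subvP => _ /mapP[k _ ->].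
  by rewrite mem_left_eigenspace; apply/eqP; have [] := zeta_eigen i j k.
have local_span i z (u : 'rV_(state_dim i)) :
    u *m cmx (self_loop_matrix i) = z *: u -> u != 0 ->
    exists2 j, mu i j = z & u \in <<[seq zeta i j k | k : 'I_(gamma i j)]>>%VS.
  move=> uM u0.
  have : spectrum (self_loop_matrix i) z by apply/spectrumP; exists u.
  rewrite mu_spectrum => -[j _ muz]; exists j => //.
  by rewrite (span_basis (zeta_basis i j)) mem_left_eigenspace muz uM.
have eigenP z (v : 'rV[R[i]]_(\sum_(i < nodes S) state_dim i)) :
    v *m cmx (network_matrix S) = z *: v <->
    forall i, submxrow v i *m cmx (self_loop_matrix i) = z *: submxrow v i.
  apply: (@network_eigenP R S z lower _ v) => i l bil lt_il u uM.
  have [->|u0] := eqVneq u 0; first by rewrite mul0mx.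
  have [j _] := local_span _ _ _ uM u0.
  (* The kernel of [x |-> x H_i C_l] is a subspace containing the [zeta i j k],
     hence also their span. *)
  pose f : 'Hom('rV[R[i]]_(state_dim i), 'rV[R[i]]_(state_dim l)) :=
    linfun (mulmxr (cmx (node_H i *m node_C l))).
  move=> u_span; apply/eqP; have -> : u *m cmx (node_H i *m node_C l) = f u.
    by rewrite lfunE.
  rewrite -memv_ker; apply: subvP u_span; apply/span_subvP => _ /mapP[k _ ->].
  by rewrite memv_ker lfunE /= upper.
have embed_eigen z i (u : 'rV_(state_dim i)) :
    u *m cmx (self_loop_matrix i) = z *: u ->
    block_embed u *m cmx (network_matrix S) = z *: block_embed u.
  move=> uM; apply/eigenP => l; have [<-|il] := eqVneq i l.
    by rewrite submxrow_embed_id.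
  by rewrite submxrow_embed_out // mul0mx scaler0.
split.
  apply/seteqP; split=> z.
    case/spectrumP => v [v0 /eigenP vM].
    have [i vi0] : exists i, submxrow v i != 0.
      apply/existsP; apply: contraNT v0; rewrite negb_exists => /forallP v0.
      by apply/eqP/mxrowP => i; rewrite submxrow0; apply/eqP;
        rewrite -[_ == _]negbK.
    by exists i => //; apply/spectrumP; exists (submxrow v i).
  case=> i _ /spectrumP[u [u0 uM]]; apply/spectrumP; exists (block_embed u).
  split; last exact: embed_eigen.
  by apply: contraNneq u0 => u0; rewrite -(submxrow_embed_id u) u0 submxrow0.
move=> z _.
pose idx i j (k : 'I_(gamma i j)) :
  {i : 'I_(nodes S) & {j : 'I_(q i) & 'I_(gamma i j)}} :=
  existT _ i (existT _ j k).
rewrite /basis_of; apply/andP; split.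
  rewrite eqEsubv; apply/andP; split.
    apply/span_subvP => _ /mapP[[i [j k]] /[!mem_enum] /= /eqP <- ->].
    rewrite mem_left_eigenspace; apply/eqP/embed_eigen.
    by have [] := zeta_eigen i j k.
  apply/subvP => v; rewrite mem_left_eigenspace => /eqP/eigenP vM.
  rewrite [v]sum_block_embed; apply: memv_suml => i _.
  have [->|vi0] := eqVneq (submxrow v i) 0; first by rewrite linear0 mem0v.
  have [j muz v_span] := local_span _ _ _ (vM i) vi0.
  have -> : block_embed (submxrow v i) =
      linfun (@block_embed R S i) (submxrow v i).
    by rewrite lfunE.
  apply: subvP (memv_img _ v_span); rewrite limg_span.
  apply/span_subvP => _ /mapP[_ /mapP[k _ ->] ->]; rewrite lfunE.
  apply/memv_span/mapP.
  by exists (idx i j k); rewrite ?mem_enum ?inE /= ?muz.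
(* The [i]-th block of a vanishing combination only retains node [i], and by
   injectivity of [mu i] only the index [j] of that node. *)
apply/free_imageP => c c0 [i [j k]] /= /eqP muz.
have /free_imageP zf := zeta_free i j.
apply: (zf (fun k => c (idx i j k))) => //.
have := congr1 (fun v => submxrow v i) c0; rewrite submxrow0 submxrow_sum => c0i.
pose G (t : {i : 'I_(nodes S) & {j : 'I_(q i) & 'I_(gamma i j)}}) :=
  submxrow (c t *: block_embed
                     (zeta (tag t) (tag (tagged t)) (tagged (tagged t)))) i.
apply: etrans c0i.
transitivity (\sum_i'
                \sum_(s : {j : 'I_(q i') & 'I_(gamma i' j)} | mu i' (tag s) == z)
                G (existT _ _ s)); last first.
  rewrite (sig_big_dep predT (fun i' s => mu i' (tag s) == z)
             (fun i' s => G (existT _ i' s))).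
  by apply: eq_big => -[].
rewrite (bigD1 i) //= [X in _ + X]big1 ?addr0; last first.
  move=> i' ne_i'i; apply: big1 => s _.
  by rewrite /G submxrowZ submxrow_embed_out // scaler0.
transitivity (\sum_(j' | mu i j' == z) \sum_(k : 'I_(gamma i j')) G (idx i j' k));
  last first.
  rewrite (sig_big_dep (fun j' => mu i j' == z) (fun _ => predT)
             (fun j' k => G (idx i j' k))).
  by apply: eq_big => [] [j' k'] //=; rewrite andbT.
rewrite (big_pred1 j) => [|j']; last by rewrite /= -muz (inj_eq (@mu_inj i)).
by apply: eq_bigr => k' _; rewrite /G submxrowZ submxrow_embed_id.
Qed.
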